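(* Let $q$ be a prime number and $d\in\mathbb{N}$. Let $f:\mathbb{F}_q^d\to\mathbb{F}_q$ be a scalar respecting function. Let $\epsilon,\delta>0$ be parameters such that $\epsilon\gg\delta\gg\frac{1}{q^{1/3}}$. If $f$ passes the test $\mathcal{T}$ with probability $\epsilon$, then there exist an integer $r=O(1/\delta^2)$ and linear functions $c_1,\ldots,c_r:\mathbb{F}_q^d\to\mathbb{F}_q$ such that $$\Pr_{(\vec{\alpha},\vec{\beta})\sim S_{f,\mathcal{T}}}\left[\exists\ \text{unique } j\in[r] \text{ such that } f(\vec{\alpha})=c_j(\vec{\alpha}),\ f(\vec{\beta})=c_j(\vec{\beta})\right]\ge 1-O\!\left(\frac{\delta}{\epsilon}\right),$$ where $(\vec\alpha,\vec\beta)$ is drawn uniformly from $S_{f,\mathcal{T}}$.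
   Context: For a function $f:\mathbb{F}_q^d\to\mathbb{F}_q^{\ell}$, the linearity test $\mathcal{T}$ picks $\vec{\alpha},\vec{\beta}\in\mathbb{F}_q^d$ uniformly and independently at random, and accepts iff $f(\vec{\alpha})+f(\vec{\beta})=f(\vec{\alpha}+\vec{\beta})$. Define $S_{f,\mathcal{T}}:=\{(\vec{\alpha},\vec{\beta})\in\mathbb{F}_q^d\times\mathbb{F}_q^d: f(\vec{\alpha})+f(\vec{\beta})=f(\vec{\alpha}+\vec{\beta})\}$. A function $c$ is linear if $c(\vec\alpha)+c(\vec\beta)=c(\vec\alpha+\vec\beta)$ for all $\vec\alpha,\vec\beta$. A function $f$ is scalar respecting if $f(\gamma\vec{\alpha})=\gamma f(\vec{\alpha})$ for all $\vec{\alpha}\in\mathbb{F}_q^d$ and $\gamma\in\mathbb{F}_q$. The notation $\epsilon\gg\delta\gg q^{-1/3}$ means each quantity is sufficiently large compared to the next (by suitable absolute constant factors). *)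

(* Defs.v *)
From mathcomp Require Export all_boot all_order all_algebra.
From mathcomp Require Export boolp reals exp.

Set Implicit Arguments.
Unset Strict Implicit.
Unset Printing Implicit Defensive.

Import Order.TTheory GRing.Theory Num.Theory.
Local Open Scope ring_scope.

(* Probability that E holds for a uniform element of A; it is only meaningful
   for A nonempty (for A = set0 the division by 0 makes it 0). *)
Definition unif_pr (R : realType) (T : finType) (A : {set T}) (E : T -> Prop)
    : R :=
  #|[pred x in A | `[< E x >]]|%:R / #|A|%:R.

Section LinearityTest.
Variables (F : finFieldType) (d : nat).
Implicit Types (f c : 'rV[F]_d -> F).

Definition scalar_respecting f : Prop :=
  forall (a : 'rV[F]_d) (g : F), f (g *: a) = g * f a.

(* Additivity only; over a prime field this amounts to F-linearity. *)
Definition linear_fun c : Prop :=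
  forall a b : 'rV[F]_d, c a + c b = c (a + b).

Definition test_accepts f (p : 'rV[F]_d * 'rV[F]_d) : bool :=
  f p.1 + f p.2 == f (p.1 + p.2).

Definition accept_set f : {set 'rV[F]_d * 'rV[F]_d} :=
  [set p | test_accepts f p].

Definition pass_pr (R : realType) f : R :=
  unif_pr R [set: 'rV[F]_d * 'rV[F]_d] (test_accepts f).

End LinearityTest.

(* Main.v *)
Require Import Defs.
From mathcomp Require Import ring lra.
From mathcomp Require Import all_field.

Set Implicit Arguments.
Unset Strict Implicit.
Unset Printing Implicit Defensive.

Import Order.TTheory GRing.Theory Num.Theory.
Local Open Scope ring_scope.

(** Write Q = q^d and let L be the set of all linear forms agreeing with f on at
    least delta Q points. Since f is homogeneous, its Fourier coefficient at a
    linear form is a real affine function of the agreement, so Parseval gives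
    |L| <= 4 / delta^2. An accepted pair (a, b) not explained by exactly one
    member of L is of one of three kinds.
    - No member of L agrees with f at a. These points form a cone P, and the
      number of accepted pairs with a in P is a sum over linear forms c of
      (Fourier coefficient of f restricted to P at c) times (Fourier coefficient
      of f at c)^2; the first factor is at most about delta Q, which gives a
      fraction delta + 1/q of all pairs.
    - Some c in L agrees with f at a but not at b. Then h = f - c satisfies
      h(b) = h(a + b) <> 0, which has probability at most 1/(q-1) because the
      nonzero level sets of h are dilates of each other.
    - Two members of L agree at both a and b: probability 1/q^2 for each pair.
    The bound q delta^3 >= 8 makes the sum of the three at most 4 delta. *)

(** * Linear forms on F^d, indexed by vectors *)

Section DotProduct.
Variables (F : finFieldType) (d : nat).
Implicit Types (c x y : 'rV[F]_d) (a : F).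

Definition dot c x : F := (c *m x^T) 0 0.

Lemma dotDl c1 c2 x : dot (c1 + c2) x = dot c1 x + dot c2 x.
Proof. by rewrite /dot mulmxDl mxE. Qed.

Lemma dotC c x : dot c x = dot x c.
Proof. by rewrite /dot -[in RHS](trmxK (x *m c^T)) trmx_mul trmxK [in RHS]mxE. Qed.

Lemma dotDr c x y : dot c (x + y) = dot c x + dot c y.
Proof. by rewrite !(dotC c) dotDl. Qed.

Lemma dotZl a c x : dot (a *: c) x = a * dot c x.
Proof. by rewrite /dot -scalemxAl mxE. Qed.

Lemma dotZr c a x : dot c (a *: x) = a * dot c x.
Proof. by rewrite !(dotC c) dotZl. Qed.

Lemma dotBl c1 c2 x : dot (c1 - c2) x = dot c1 x - dot c2 x.
Proof. by rewrite -scaleN1r dotDl dotZl mulN1r. Qed.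

Lemma dotBr c x y : dot c (x - y) = dot c x - dot c y.
Proof. by rewrite !(dotC c) dotBl. Qed.

Lemma dot0r c : dot c 0 = 0.
Proof. by rewrite -(scale0r 0) dotZr mul0r. Qed.

Lemma dot_onto x a : x != 0 -> exists c, dot c x = a.
Proof.
move=> /eqP x_neq0; have [i xi]: exists i, x 0 i != 0.
  apply/existsP; apply: contra_notT x_neq0 => /existsPn x0.
  by apply/rowP => i; rewrite mxE; apply/eqP; move: (x0 i); rewrite negbK.
exists ((a / x 0 i) *: delta_mx 0 i).
by rewrite dotZl /dot -rowE !mxE divfK.
Qed.

Lemma dot_linear c : linear_fun (dot c).
Proof. by move=> x y; rewrite dotDr. Qed.

End DotProduct.

Lemma natr_card_set (C : pzSemiRingType) (T : finType) (P : pred T) :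
  \sum_(x : T) (P x)%:R = #|[set x | P x]|%:R :> C.
Proof. by rewrite -natr_sum -sum1dep_card [in RHS]big_mkcond. Qed.

(** * Fourier analysis of homogeneous functions *)

Section HomogeneousFourier.
Variables (F : finFieldType) (d : nat) (C : numDomainType) (chi : F -> C).
Hypothesis chi0 : chi 0 = 1.
Hypothesis chiD : {morph chi : a b / a + b >-> a * b}.
Hypothesis chi_nontrivial : exists s, chi s != 1.

Local Notation V := 'rV[F]_d.
Local Notation q := #|F|.
Local Notation Q := #|{: V}|.

Lemma sum_chi_mul (t : F) : \sum_(g : F) chi (g * t) = q%:R * (t == 0)%:R.
Proof.
have [->|t0] := eqVneq t 0.
  by under eq_bigr do rewrite mulr0 chi0; rewrite sumr_const mulr1.
have [s s1] := chi_nontrivial.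
rewrite mulr0; apply/eqP; set S := (X in X == 0).
(* Translating the index by [s / t] multiplies the sum by [chi s], which differs from 1, so the sum
   vanishes. *)
have : chi s * S = S.
  rewrite mulr_sumr /S [RHS](reindex_inj (addrI (s / t))) /=.
  by apply: eq_bigr => g _; rewrite mulrDl divfK // chiD.
move/eqP; rewrite -subr_eq0 -{2}[S]mul1r -mulrBl mulf_eq0 subr_eq0.
by rewrite (negbTE s1).
Qed.

Lemma sum_chi_dot (x : V) : \sum_(c : V) chi (dot c x) = Q%:R * (x == 0)%:R.
Proof.
have [->|x0] := eqVneq x 0.
  by under eq_bigr do rewrite dot0r chi0; rewrite sumr_const mulr1.
have [s s1] := chi_nontrivial; have [y yx] := dot_onto s x0.
rewrite mulr0; apply/eqP; set S := (X in X == 0).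
have : chi s * S = S.
  rewrite mulr_sumr /S [RHS](reindex_inj (addrI y)) /=.
  by apply: eq_bigr => c _; rewrite dotDl chiD yx.
move/eqP; rewrite -subr_eq0 -{2}[S]mul1r -mulrBl mulf_eq0 subr_eq0.
by rewrite (negbTE s1).
Qed.

(** Evaluate the double sum of [chi (g * dot c x)] in two ways: summing over g first detects the
    kernel of [dot c], summing over x first leaves only g = 0. *)
Lemma card_dot_eq0 (c : V) : c != 0 ->
  (q * #|[set x | dot c x == 0]|)%:R = Q%:R :> C.
Proof.
move=> c0; rewrite natrM -natr_card_set mulr_sumr.
under eq_bigr do rewrite -sum_chi_mul.
rewrite exchange_big /=.
under eq_bigr => g _ do
  [under eq_bigr do rewrite -dotZl dotC; rewrite sum_chi_dot scaler_eq0 (negbTE c0) orbF].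
by rewrite -mulr_sumr (bigD1 0) //= eqxx big1 ?addr0 ?mulr1 // => i /negbTE->.
Qed.

Definition agreement (P : {set V}) (f : V -> F) (c : V) : nat :=
  #|[set x in P | f x == dot c x]|.

(** Only nonzero dilations are allowed: for homogeneous f, the set of unexplained points misses 0 as
    soon as L is nonempty. *)
Definition cone (P : {set V}) : Prop :=
  forall (g : F) x, g != 0 -> x \in P -> g *: x \in P.

Lemma cone_scale (P : {set V}) (g : F) x :
  cone P -> g != 0 -> (g *: x \in P) = (x \in P).
Proof.
move=> coneP g0; apply/idP/idP => [gx|]; last exact: coneP.
by rewrite -(scalerK g0 x) coneP ?invr_eq0.
Qed.

(* Averaging over the lines through 0 makes the character sum of a homogeneous
   function an integer combination of counts, in particular a real number. *)
Lemma sum_chi_cone (P : {set V}) (h : V -> F) :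
  cone P -> scalar_respecting h ->
  (q%:R - 1) * \sum_(x in P) chi (h x) =
  q%:R * #|[set x in P | h x == 0]|%:R - #|P|%:R.
Proof.
move=> coneP hZ.
have -> : (q%:R - 1) * \sum_(x in P) chi (h x) =
          \sum_(g : F | g != 0) \sum_(x in P) chi (g * h x).
  have H (g : F) : g != 0 ->
      \sum_(x in P) chi (g * h x) = \sum_(x in P) chi (h x).
    move=> g0; rewrite [RHS](reindex_inj (can_inj (scalerK g0))) /=.
    by apply: eq_big => [x|x _]; rewrite ?cone_scale ?hZ.
  rewrite (eq_bigr _ H) sumr_const -[RHS]mulr_natl; congr (_ * _).
  have := cardC1 (0 : F); rewrite (eq_card (B := [pred g | g != 0])) // => ->.
  by rewrite -subn1 natrB //; apply/card_gt0P; exists 0.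
rewrite exchange_big /=.
have -> : #|[set x in P | h x == 0]|%:R = \sum_(x in P) (h x == 0)%:R :> C.
  rewrite -natr_card_set [RHS]big_mkcond; apply: eq_bigr => x _.
  by case: (x \in P).
rewrite -(sum1_card (mem P)) natr_sum mulr_sumr -sumrB; apply: eq_bigr => x _.
by rewrite -sum_chi_mul [in RHS](bigD1 0) //= mul0r chi0 addrC addrK.
Qed.

Lemma scalar_respecting_subdot (f : V -> F) c :
  scalar_respecting f -> scalar_respecting (fun x => f x - dot c x).
Proof. by move=> fZ x g; rewrite fZ dotZr mulrBr. Qed.

Lemma scalar_respecting_opp (f : V -> F) :
  scalar_respecting f -> scalar_respecting (fun x => - f x).
Proof. by move=> fZ x g; rewrite fZ mulrN. Qed.

Lemma cone_setT : cone setT.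
Proof. by move=> g x; rewrite !inE. Qed.

Lemma sum_chi_subdot (P : {set V}) (f : V -> F) c :
  cone P -> scalar_respecting f ->
  (q%:R - 1) * \sum_(x in P) chi (f x - dot c x) =
  q%:R * (agreement P f c)%:R - #|P|%:R.
Proof.
move=> coneP fZ; rewrite (sum_chi_cone coneP (scalar_respecting_subdot c fZ)).
congr (_ * _%:R - _); apply: eq_card => x.
by rewrite !inE subr_eq0.
Qed.

(** A homogeneous function and its opposite have the same zeros, hence the same character sum. This
    turns the last two factors of [triple_sum_fourier] into a square. *)
Lemma sum_chi_oppdot (f : V -> F) c :
  scalar_respecting f ->
  (q%:R - 1) * \sum_(x in setT) chi (- (f x - dot c x)) =
  q%:R * (agreement setT f c)%:R - Q%:R.
Proof.
move=> fZ; rewrite (sum_chi_cone cone_setT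
  (scalar_respecting_opp (scalar_respecting_subdot c fZ))) cardsT.
congr (_ * _%:R - _); apply: eq_card => x.
by rewrite !inE oppr_eq0 subr_eq0.
Qed.

Definition triple_sum (P : {set V}) (f : V -> F) : C :=
  \sum_(x in P) \sum_(y in setT) chi (f x + f y - f (x + y)).

(** After expanding the product, the sum over c of [chi (dot c (z - (x + y)))] vanishes unless z = x
    + y. *)
Lemma triple_sum_fourier (P : {set V}) (f : V -> F) :
  Q%:R * triple_sum P f =
  \sum_(c : V) (\sum_(x in P) chi (f x - dot c x)) *
     (\sum_(y in setT) chi (f y - dot c y)) *
     (\sum_(z in setT) chi (- (f z - dot c z))).
Proof.
under [RHS]eq_bigr => c _.
  rewrite -mulrA mulr_suml.
  under eq_bigr => x _.
    rewrite mulr_suml mulr_sumr.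
    under eq_bigr => y _.
      rewrite mulr_sumr mulr_sumr.
      under eq_bigr => z _.
        rewrite -!chiD.
        have -> : f x - dot c x + (f y - dot c y + - (f z - dot c z)) =
          (f x + f y - f z) + dot c (z - (x + y)).
          by rewrite dotBr dotDr; ring.
        rewrite chiD.
        over.
      over.
    over.
  over.
rewrite exchange_big mulr_sumr; apply: eq_bigr => x _.
rewrite exchange_big mulr_sumr; apply: eq_bigr => y _.
rewrite exchange_big (bigD1 (x + y)) ?inE //=.
rewrite -[LHS]addr0; congr (_ + _).
  by rewrite -mulr_sumr sum_chi_dot subrr eqxx mulr1 mulrC.
rewrite big1 // => z /andP[_ zxy].
by rewrite -mulr_sumr sum_chi_dot subr_eq0 (negbTE zxy) !mulr0.
Qed.

Lemma card_field_gt1 : (1 < q)%N.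
Proof. exact: finNzRing_gt1. Qed.

Lemma card_vec_gt0 : (0 < Q)%N.
Proof. by apply/card_gt0P; exists 0. Qed.

Lemma triple_sum_agreement (P : {set V}) (f : V -> F) :
  cone P -> scalar_respecting f ->
  (q%:R - 1) ^+ 3 * Q%:R * triple_sum P f =
  \sum_(c : V) (q%:R * (agreement P f c)%:R - #|P|%:R) *
               (q%:R * (agreement setT f c)%:R - Q%:R) ^+ 2.
Proof.
move=> coneP fZ; rewrite -mulrA triple_sum_fourier mulr_sumr.
apply: eq_bigr => c _; rewrite -sum_chi_subdot // expr2.
rewrite -{1}(sum_chi_oppdot c fZ).
by rewrite -[in RHS](cardsT V) -(sum_chi_subdot c cone_setT fZ); ring.
Qed.

(** This is [triple_sum_agreement] on the cone {0}: there the triple sum is Q, and every linear form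
    agrees with f at 0, so the first factor is the constant q - 1. *)
Lemma parseval_agreement (f : V -> F) : scalar_respecting f ->
  \sum_(c : V) (q%:R * (agreement setT f c)%:R - Q%:R) ^+ 2 =
  (q%:R - 1) ^+ 2 * Q%:R ^+ 2 :> C.
Proof.
move=> fZ.
have f0 : f 0 = 0 by rewrite -(scale0r 0) fZ mul0r.
have cone0 : cone [set 0].
  by move=> g x _; rewrite !inE => /eqP->; rewrite scaler0.
have q1 : q%:R - 1 != 0 :> C.
  by rewrite subr_eq0 (eqr_nat C q 1) neq_ltn card_field_gt1 orbT.
apply: (mulfI q1).
have := triple_sum_agreement cone0 fZ.
rewrite /triple_sum big_set1.
under eq_bigr => y _ do rewrite f0 !add0r subrr chi0.
rewrite sumr_const cardsT => E.
rewrite [RHS](_ : _ = (q%:R - 1) ^+ 3 * Q%:R * Q%:R); last by ring.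
rewrite E mulr_sumr; apply: eq_bigr => c _.
suff -> : agreement [set 0] f c = 1%N by rewrite cards1 mulr1.
apply/eqP/cards1P; exists 0; apply/setP => x.
by rewrite !inE; case: eqVneq => // ->; rewrite f0 dot0r eqxx.
Qed.

Definition accepted_from (P : {set V}) (f : V -> F) : {set V * V} :=
  [set p in accept_set f | p.1 \in P].

(** Acceptance is detected by summing [chi (g * D x y)] over g. The term g = 0 gives the main term;
    for g != 0, dilating x and y by g shows that each term equals [triple_sum P f]. *)
Lemma card_accepted_from (P : {set V}) (f : V -> F) :
  cone P -> scalar_respecting f ->
  q%:R * #|accepted_from P f|%:R =
  #|P|%:R * Q%:R + (q%:R - 1) * triple_sum P f.
Proof.
move=> coneP fZ.
pose D x y : F := f x + f y - f (x + y).
have -> : #|accepted_from P f|%:R =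
    \sum_(x in P) \sum_(y in setT) (D x y == 0)%:R :> C.
  rewrite pair_big /= -natr_card_set [RHS]big_mkcond.
  apply: eq_bigr => -[x y] _; rewrite !inE /test_accepts /= subr_eq0 andbT.
  by case: (x \in P); rewrite (andbT, andbF).
have -> : q%:R * (\sum_(x in P) \sum_(y in setT) (D x y == 0)%:R) =
   \sum_(g : F) \sum_(x in P) \sum_(y in setT) chi (g * D x y).
  rewrite [RHS]exchange_big mulr_sumr; apply: eq_bigr => x _.
  rewrite [RHS]exchange_big mulr_sumr; apply: eq_bigr => y _.
  by rewrite sum_chi_mul.
rewrite (bigD1 0) //=; congr (_ + _).
  under eq_bigr => x _ do
    [under eq_bigr => y _ do rewrite mul0r chi0; rewrite sumr_const cardsT].
  by rewrite sumr_const -[LHS]mulr_natl.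
rewrite (eq_bigr (fun=> triple_sum P f)) => [|g g0].
  rewrite sumr_const -[LHS]mulr_natl; congr (_ * _).
  have := cardC1 (0 : F); rewrite (eq_card (B := [pred g | g != 0])) // => ->.
  by rewrite -subn1 natrB // ltnW ?card_field_gt1.
rewrite /triple_sum [RHS](reindex_inj (can_inj (scalerK g0))) /=.
apply: eq_big => [x|x _]; first by rewrite cone_scale.
rewrite [RHS](reindex_inj (can_inj (scalerK g0))) /=.
apply: eq_big => [y|y _]; first by rewrite !inE.
by rewrite -scalerDr !fZ /D -mulrDr -mulrBr.
Qed.

(** In [triple_sum_agreement] the first factor is at most q m for every c, and Parseval evaluates
    the sum of the remaining squares. *)
Lemma card_accepted_from_le (P : {set V}) (f : V -> F) (m : nat) :
  cone P -> scalar_respecting f -> (forall c, agreement P f c <= m)%N ->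
  (q * #|accepted_from P f|)%:R <= (#|P| * Q + q * m * Q)%:R :> C.
Proof.
move=> coneP fZ agr_le.
rewrite natrM card_accepted_from // natrD natrM lerD2l.
have q1 : 0 < q%:R - 1 :> C by rewrite subr_gt0 (ltr_nat C 1 q) card_field_gt1.
have Q0 : 0 < Q%:R :> C by rewrite ltr0n card_vec_gt0.
have k0 : 0 < (q%:R - 1) ^+ 2 * Q%:R :> C by rewrite mulr_gt0 ?exprn_gt0.
rewrite -(ler_pM2l k0).
have -> : (q%:R - 1) ^+ 2 * Q%:R * ((q%:R - 1) * triple_sum P f) =
  (q%:R - 1) ^+ 3 * Q%:R * triple_sum P f by ring.
have -> : (q%:R - 1) ^+ 2 * Q%:R * (q * m * Q)%:R =
  (q * m)%:R * ((q%:R - 1) ^+ 2 * Q%:R ^+ 2) :> C by rewrite !natrM; ring.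
rewrite triple_sum_agreement // -(parseval_agreement fZ) mulr_sumr.
apply: ler_sum => c _; apply: ler_wpM2r.
  (* The order on [C] need not be total, so squares are nonnegative only for real elements. *)
  by rewrite real_exprn_even_ge0 // -natrM rpredB ?realn.
rewrite lerBlDr -natrM -natrD ler_nat (leq_trans _ (leq_addr _ _)) //.
by rewrite leq_mul2l agr_le orbT.
Qed.

End HomogeneousFourier.

(** * Level sets, and a union bound on badly explained pairs *)

Section Counting.
Variables (F : finFieldType) (d : nat).
Local Notation V := 'rV[F]_d.
Local Notation q := #|F|.
Local Notation Q := #|{: V}|.
Implicit Types (f h : V -> F) (L : {set V}).

(** The dilates of the level set by the q - 1 nonzero scalars are pairwise disjoint, since h takes
    the value a t on the dilate by a. *)
Lemma card_level_set h (t : F) : scalar_respecting h -> t != 0 ->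
  (q.-1 * #|[set x | h x == t]| <= Q)%N.
Proof.
move=> hZ t0.
have <- : #|[set~ 0 : F]| = q.-1 by rewrite cardsC1.
rewrite -cardsX.
rewrite -(card_in_imset (f := fun p : F * V => p.1 *: p.2)) ?max_card //.
move=> [a x] [b y]; rewrite !inE /= => /andP[a0 /eqP hx] /andP[_ /eqP hy] E.
have ab : a = b by apply: (mulIf t0); rewrite -{1}hx -hy -!hZ E.
by move: E; rewrite -ab => /(scalerI a0) ->.
Qed.

Definition collisions h : {set V * V} :=
  [set p | (h p.1 != 0) && (h p.2 == h p.1)].

(* The nonzero level sets of a homogeneous function have equal size, so a
   random pair collides at a nonzero value with probability at most 1/(q-1). *)
Lemma card_collision h : scalar_respecting h ->
  (q.-1 * #|collisions h| <= Q * Q)%N.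
Proof.
move=> hZ; rewrite -sum1dep_card -(pair_big_dep (fun x => h x != 0)
  (fun x y => h y == h x) (fun _ _ => 1%N)) /= big_distrr /=.
apply: (@leq_trans (\sum_(x : V | h x != 0) Q)).
  by apply: leq_sum => x hx; rewrite sum1dep_card card_level_set.
by rewrite sum_nat_const leq_mul2r max_card orbT.
Qed.

Definition half_explained f c : {set V * V} :=
  [set p in accept_set f | (f p.1 == dot c p.1) && (f p.2 != dot c p.2)].

(** The injection (a, b) -> (b, a + b) sends these pairs to collisions of f - [dot c]. *)
Lemma card_half_explained f c : scalar_respecting f ->
  (q.-1 * #|half_explained f c| <= Q * Q)%N.
Proof.
move=> fZ; apply: leq_trans (card_collision (scalar_respecting_subdot c fZ)).
rewrite leq_mul2l; apply/orP; right.
rewrite -(card_imset _ (f := fun p : V * V => (p.2, p.1 + p.2))); last first.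
  by move=> [a x] [b y] [/= -> /addIr ->].
apply/subset_leq_card/subsetP => _ /imsetP[[a b] + ->].
rewrite !inE /test_accepts /= => /and3P[/eqP <- /eqP fa fb].
by rewrite subr_eq0 fb dotDr fa opprD addrACA subrr add0r eqxx.
Qed.

Definition hyperplane c : {set V} := [set x | dot c x == 0].

Lemma leq_card_bigcup (T I : finType) (P : pred I) (B : I -> {set T}) :
  (#|\bigcup_(i | P i) B i| <= \sum_(i | P i) #|B i|)%N.
Proof.
elim/big_rec2: _ => [|i n S _ le]; first by rewrite cards0.
by rewrite (leq_trans (leq_card_setU _ _)) // leq_add2l.
Qed.

Definition unexplained L f : {set V} := [set x | [forall c in L, f x != dot c x]].

Definition explaining L f (p : V * V) : {set V} :=
  [set c in L | (f p.1 == dot c p.1) && (f p.2 == dot c p.2)].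

Lemma unexplained_cone L f : scalar_respecting f -> cone (unexplained L f).
Proof.
move=> fZ g x g0; rewrite !inE => /forall_inP Lx; apply/forall_inP => c cL.
by rewrite fZ dotZr (inj_eq (mulfI g0)) Lx.
Qed.

Definition distinct_pairs L : {set V * V} :=
  [set e | [&& e.1 \in L, e.2 \in L & e.1 - e.2 != 0]].

Lemma card_not_uniquely_explained L f :
  (#|[set p in accept_set f | #|explaining L f p| != 1%N]| <=
   #|accepted_from (unexplained L f) f| +
   \sum_(c in L) #|half_explained f c| +
   \sum_(e in distinct_pairs L) #|hyperplane (e.1 - e.2)%R| ^ 2)%N.
Proof.
under [X in (_ <= _ + X)%N]eq_bigr do rewrite -mulnn -cardsX.
apply: leq_trans (leq_add (leq_add (leqnn _) (leq_card_bigcup _ _))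
                          (leq_card_bigcup _ _)).
apply: leq_trans (leq_trans (leq_card_setU _ _)
                    (leq_add (leq_card_setU _ _) (leqnn _))).
apply/subset_leq_card/subsetP => p.
rewrite inE => /andP[pA pE]; rewrite !inE.
have pA' : test_accepts f p by move: pA; rewrite inE.
case: (boolP [forall c in L, _]) => [_|]; first by rewrite pA'.
rewrite negb_forall_in => /exists_inP[c cL]; rewrite negbK => fc.
case: (boolP (f p.2 == dot c p.2)) => fc2; last first.
  apply/orP; left; apply/orP; right; apply/bigcupP; exists c => //.
  by rewrite !inE pA' fc fc2.
apply/orP; right; apply/bigcupP.
(* Now c explains p, so a count other than 1 yields a second form c'; both points of p then lie in
   the hyperplane of c - c'. *)
have cE : c \in explaining L f p by rewrite inE cL fc fc2.
have [c' c'E ne] : exists2 c', c' \in explaining L f p & c != c'.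
  apply/exists_inP; apply: contraNT pE => /exists_inPn H.
  apply/cards1P; exists c; apply/setP => c'; rewrite in_set1.
  apply/idP/eqP => [/H|->//]; by rewrite negbK => /eqP.
move: c'E; rewrite inE => /and3P[c'L fc' fc2'].
exists (c, c'); rewrite !inE /= ?cL ?c'L ?subr_eq0 //.
by rewrite !dotBl -(eqP fc) -(eqP fc') -(eqP fc2) -(eqP fc2') !subrr eqxx.
Qed.

End Counting.

(** * Prime fields: a nontrivial character, and its elimination from the counts *)

Lemma Fp_character (q : nat) : prime q ->
  exists chi : 'F_q -> algC,
  [/\ chi 0 = 1, {morph chi : a b / a + b >-> a * b} & exists s, chi s != 1].
Proof.
move=> q_pr; have [w w_prim] := C_prim_root_exists (prime_gt0 q_pr).
exists (fun a => w ^+ (a : nat)); split=> [|a b|].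
- by rewrite expr0.
- rewrite -exprD -(prim_expr_mod w_prim (a + b)); congr (_ ^+ _).
  (* The modulus built into ['F_q] is a term computed from q, equal to q because q is prime. *)
  by congr (_ %% _)%N; exact: Fp_cast.
- exists 1; rewrite /= modn_small ?expr1; last by rewrite ltnS.
  apply/eqP => w1; have := prim_order_dvd w_prim 1.
  by rewrite expr1 w1 eqxx dvdn1 => /eqP q1; move: q_pr; rewrite q1.
Qed.

Section PrimeField.
Variables (q d : nat) (q_pr : prime q).
Local Notation V := 'rV['F_q]_d.
Local Notation Q := #|{: V}|.
Implicit Types (f : V -> 'F_q) (L : {set V}).

Lemma card_hyperplane (c : V) : c != 0 -> (q * #|hyperplane c|)%N = Q.
Proof.
have [chi [chi0 chiD chi1]] := Fp_character q_pr => c0.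
have /eqP := card_dot_eq0 chi0 chiD chi1 c0.
by rewrite (card_Fp q_pr) eqr_nat => /eqP.
Qed.

(** The identity in [algC] relates images of integers, so it holds in the integers and maps to any
    ring. *)
Lemma parseval_Fp (R : pzRingType) f : scalar_respecting f ->
  \sum_(c : V) (q%:R * (agreement setT f c)%:R - Q%:R) ^+ 2 =
  (q%:R - 1) ^+ 2 * Q%:R ^+ 2 :> R.
Proof.
have [chi [chi0 chiD chi1]] := Fp_character q_pr => fZ.
have := parseval_agreement chi0 chiD chi1 fZ; rewrite (card_Fp q_pr) => E.
have EZ : \sum_(c : V) (q%:Z * (agreement setT f c)%:Z - Q%:Z) ^+ 2 =
  (q%:Z - 1) ^+ 2 * Q%:Z ^+ 2.
  apply: (@intr_inj algC); rewrite rmorph_sum /= rmorphM !rmorphXn rmorphB /=.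
  rewrite -[RHS]E; apply: eq_bigr => c _.
  by rewrite rmorphXn rmorphB rmorphM.
have := congr1 (intmul (1 : R)) EZ.
rewrite rmorph_sum /= rmorphM !rmorphXn rmorphB /= => <-.
by apply: eq_bigr => c _; rewrite rmorphXn rmorphB rmorphM.
Qed.

Lemma card_accepted_from_Fp (P : {set V}) f (m : nat) :
  cone P -> scalar_respecting f -> (forall c, agreement P f c <= m)%N ->
  (q * #|accepted_from P f| <= #|P| * Q + q * m * Q)%N.
Proof.
have [chi [chi0 chiD chi1]] := Fp_character q_pr => coneP fZ agr_le.
have := card_accepted_from_le chi0 chiD chi1 coneP fZ agr_le.
by rewrite (card_Fp q_pr) ler_nat.
Qed.

End PrimeField.

(** * The linear forms of large agreement, and the count of bad pairs *)

Section LargeAgreement.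
Variables (R : realType) (q d : nat) (q_pr : prime q).
Local Notation V := 'rV['F_q]_d.
Local Notation Q := #|{: V}|.
Variables (f : V -> 'F_q) (delta : R).
Hypotheses (fZ : scalar_respecting f) (delta_gt0 : 0 < delta).

Definition large_agreement : {set V} :=
  [set c | delta * Q%:R <= (agreement setT f c)%:R].
Local Notation L := large_agreement.

Let q_gt0 : 0 < q%:R :> R.
Proof. by rewrite ltr0n prime_gt0. Qed.

Let Q_gt0 : 0 < Q%:R :> R.
Proof. by rewrite ltr0n card_vec_gt0. Qed.

(** As q delta >= 2, subtracting Q from q times the agreement of a member of L leaves at least q
    delta Q / 2; the squares of these sum to at most (q Q)^2 by Parseval. *)
Lemma card_large_agreement : 2 <= q%:R * delta ->
  #|L|%:R * delta ^+ 2 <= 4.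
Proof.
move=> qd2.
have q1 : 1 <= q%:R :> R by rewrite ler1n prime_gt0.
have k0 : 0 < (q%:R * Q%:R) ^+ 2 :> R by rewrite exprn_gt0 ?mulr_gt0.
rewrite -(ler_pM2r k0).
have H : \sum_(c in L) (q%:R * delta * Q%:R / 2) ^+ 2 <=
    (q%:R - 1) ^+ 2 * Q%:R ^+ 2 :> R.
  rewrite -(parseval_Fp q_pr R fZ) big_mkcond; apply: ler_sum => c _.
  case: ifP; last by rewrite sqr_ge0.
  rewrite inE => /(ler_wpM2l (ltW q_gt0)); rewrite mulrA => agr_ge.
  have Q0 := Q_gt0; have qdQ := ler_wpM2r (ltW Q_gt0) qd2.
  rewrite lerXn2r ?nnegrE //.
  - by rewrite !mulr_ge0 ?invr_ge0 // ltW.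
  - by rewrite subr_ge0; lra.
  - by lra.
move: H; rewrite sumr_const -[X in X <= _]mulr_natl => H.
have H2 : (q%:R - 1) ^+ 2 <= q%:R ^+ 2 :> R by rewrite lerXn2r ?nnegrE; lra.
have {}H2 := ler_wpM2r (sqr_ge0 Q%:R) H2.
lra.
Qed.

(** A member of L agrees with f at no unexplained point; any other form has small agreement on the
    whole space already. *)
Lemma agreement_unexplained_le c :
  (agreement (unexplained L f) f c)%:R <= delta * Q%:R.
Proof.
have [cL|] := boolP (c \in L).
  rewrite (_ : agreement _ _ _ = 0%N) ?mulr_ge0 ?ltW //.
  apply/eqP; rewrite cards_eq0; apply/eqP/setP => x; rewrite !inE.
  apply/negP => /andP[/forall_inP/(_ c cL) /negP]; exact.
rewrite inE -ltNge => /ltW; apply: le_trans; rewrite ler_nat.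
by apply/subset_leq_card/subsetP => x; rewrite !inE => /andP[_ ->].
Qed.

Lemma card_accepted_unexplained :
  #|accepted_from (unexplained L f) f|%:R <= Q%:R ^+ 2 * (q%:R^-1 + delta).
Proof.
(* The counting bound wants a natural number, and [delta * Q] need not be one; the maximum is
   attained, so it inherits the real bound. *)
pose m := \max_(c : V) agreement (unexplained L f) f c.
have agr_le c : (agreement (unexplained L f) f c <= m)%N by exact: bigop.leq_bigmax.
have m_le : m%:R <= delta * Q%:R.
  have [c mE] :=
    bigop.eq_bigmax (agreement (unexplained L f) f) (card_vec_gt0 _ d).
  by rewrite /m mE agreement_unexplained_le.
have := card_accepted_from_Fp q_pr (unexplained_cone fZ) fZ agr_le.
rewrite -(ler_nat R) natrD !natrM => H.
have B_le : #|unexplained L f|%:R <= Q%:R :> R by rewrite ler_nat max_card.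
rewrite -(ler_pM2l q_gt0); apply: le_trans H _.
have -> : q%:R * (Q%:R ^+ 2 * (q%:R^-1 + delta)) =
  Q%:R * Q%:R + q%:R * (delta * Q%:R) * Q%:R :> R.
  by field; rewrite gt_eqF.
by rewrite lerD // ler_pM2r // ler_pM2l.
Qed.

Lemma card_bad_large_agreement : delta <= 1 -> 8 <= q%:R * delta ^+ 3 ->
  #|[set p in accept_set f | #|explaining L f p| != 1%N]|%:R <=
  4 * delta * Q%:R ^+ 2.
Proof.
move=> d1 qd3.
have d3 : delta ^+ 3 <= delta by rewrite ler_iXnr // ltW.
have qd2 : 2 <= q%:R * delta by have := ler_wpM2l (ltW q_gt0) d3; lra.
have Lle := card_large_agreement qd2.
have := card_not_uniquely_explained L f.
rewrite -(ler_nat R) !natrD => /le_trans; apply.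
have Q2 : 0 < Q%:R ^+ 2 :> R by rewrite exprn_gt0.
have qV : q%:R^-1 <= delta ^+ 3 / 8.
  by rewrite ler_pdivlMr // mulrC ler_pdivrMr // mulrC.
have E1 : #|accepted_from (unexplained L f) f|%:R <= 2 * delta * Q%:R ^+ 2.
  apply: le_trans card_accepted_unexplained _.
  rewrite [X in X <= _]mulrC ler_pM2r //; set z := q%:R^-1 in qV *.
  by move: delta_gt0; lra.
have q1 : 0 < q.-1%:R :> R by rewrite ltr0n -ltnS prednK ?prime_gt0 ?prime_gt1.
(* With |L| <= 4 / delta^2 this needs (q - 1) delta^3 >= 4, which follows from q delta^3 >= 8 and q
   <= 2 (q - 1). *)
have E2 : (\sum_(c in L) #|half_explained f c|)%:R <= delta * Q%:R ^+ 2.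
  apply: (@le_trans _ _ (\sum_(c in L) (Q%:R ^+ 2 / q.-1%:R))).
    rewrite natr_sum; apply: ler_sum => c _; rewrite ler_pdivlMr // mulrC.
    have := card_half_explained c fZ.
    by rewrite card_Fp // -(ler_nat R) !natrM -expr2.
  rewrite sumr_const -[X in X <= _]mulr_natl mulrCA [X in X <= _]mulrC.
  rewrite ler_pM2r // ler_pdivrMr //.
  have qE : q%:R = q.-1%:R + 1 :> R by rewrite natr1 prednK ?prime_gt0.
  have q2 : 1 <= q.-1%:R :> R by rewrite ler1n -(ltr0n R).
  have dd : 0 < delta ^+ 2 by rewrite exprn_gt0.
  rewrite -(ler_pM2r dd); apply: le_trans Lle _.
  have d30 : 0 <= delta ^+ 3 by rewrite exprn_ge0 // ltW.
  have := ler_wpM2r d30 q2; move: qd3; rewrite qE; lra.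
(* There are at most 16 / delta^4 pairs, and q^2 delta^5 >= q^2 delta^6 >= 64. *)
have E3 : (\sum_(e in distinct_pairs L) #|hyperplane (e.1 - e.2)| ^ 2)%:R <=
    delta * Q%:R ^+ 2.
  apply: (@le_trans _ _ (\sum_(e in distinct_pairs L) (Q%:R / q%:R) ^+ 2)).
    rewrite natr_sum; apply: ler_sum => e; rewrite inE => /and3P[_ _ e0].
    rewrite -(card_hyperplane q_pr e0) natrM mulrAC divff ?gt_eqF // mul1r.
    by rewrite natrX.
  rewrite sumr_const -[X in X <= _]mulr_natl expr_div_n mulrCA.
  rewrite [X in X <= _]mulrC ler_pM2r //.
  have : #|distinct_pairs L|%:R <= #|L|%:R ^+ 2 :> R.
    rewrite -natrX ler_nat -mulnn -cardsX; apply/subset_leq_card/subsetP => e.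
    by rewrite !inE => /and3P[-> ->].
  move=> H; rewrite ler_pdivrMr ?exprn_gt0 //; apply: le_trans H _.
  have d4 : 0 < delta ^+ 4 by rewrite exprn_gt0.
  rewrite -(ler_pM2r d4).
  have -> : #|L|%:R ^+ 2 * delta ^+ 4 = (#|L|%:R * delta ^+ 2) ^+ 2 by ring.
  have H1 : (#|L|%:R * delta ^+ 2) ^+ 2 <= 4 ^+ 2.
    by rewrite lerXn2r ?nnegrE // mulr_ge0 ?ler0n ?exprn_ge0 ?ltW.
  have H2 : 8 ^+ 2 <= (q%:R * delta ^+ 3) ^+ 2.
    by rewrite lerXn2r ?nnegrE //; apply: le_trans qd3.
  have H3 : 0 <= q%:R ^+ 2 * delta ^+ 5 by rewrite mulr_ge0 ?exprn_ge0 ?ltW.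
  have := ler_wpM2l H3 d1; lra.
lra.
Qed.

End LargeAgreement.

Theorem theorem3p1 (R : realType) :
  exists K1 K2 C1 C2 : R,
    [/\ 0 < K1, 0 < K2, 0 < C1 & 0 < C2] /\
    forall (q d : nat) (f : 'rV['F_q]_d -> 'F_q) (eps delta : R),
      prime q ->
      scalar_respecting f ->
      0 < eps -> 0 < delta ->
      K1 * delta <= eps ->
      K2 * (q%:R `^ (- 3^-1)) <= delta ->
      pass_pr R f = eps ->
      exists (r : nat) (c : 'I_r -> 'rV['F_q]_d -> 'F_q),
        [/\ r%:R <= C1 / delta ^+ 2,
            forall j, linear_fun (c j) &
            1 - C2 * (delta / eps) <=
            unif_pr R (accept_set f)
              (fun p => exists! j : 'I_r,
                 f p.1 = c j p.1 /\ f p.2 = c j p.2)].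
Proof.
(* [K1] = 1 gives delta <= eps <= 1; [K2] = 2, cubed, gives q delta^3 >= 8; [C1] = 4 comes from
   Parseval; [C2] = 4 from the bad pairs, at most 4 delta Q^2 among the eps Q^2 accepted ones. *)
exists 1, 2, 4, 4; split; first by split; lra.
move=> q d f eps delta q_pr fZ eps0 delta0; rewrite mul1r => d_eps q_delta epsE.
set Q := #|{: 'rV['F_q]_d}|.
have Q0 : 0 < Q%:R :> R by rewrite ltr0n card_vec_gt0.
have q0 : 0 < q%:R :> R by rewrite ltr0n prime_gt0.
have accE : #|accept_set f|%:R = eps * Q%:R ^+ 2.
  rewrite -epsE /pass_pr /unif_pr cardsT card_prod natrM -expr2.
  rewrite divfK ?expf_neq0 ?gt_eqF //; congr _%:R; apply: eq_card => p.
  by rewrite !inE /=; apply/idP/asboolP.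
have eps1 : eps <= 1.
  have : #|accept_set f|%:R <= Q%:R ^+ 2 :> R.
    by rewrite -natrX ler_nat -mulnn -card_prod max_card.
  by rewrite accE ger_pMl // exprn_gt0.
have d1 : delta <= 1 by apply: le_trans eps1.
have qd3 : 8 <= q%:R * delta ^+ 3.
  have H : (2 * q%:R `^ (- 3^-1)) ^+ 3 <= delta ^+ 3.
    by rewrite lerXn2r ?nnegrE ?mulr_ge0 ?powR_ge0 // ltW.
  move: H; rewrite exprMn -(powR_mulrn 3 (powR_ge0 _ _)) -powRrM.
  rewrite mulNr mulVf ?pnatr_eq0 // (powR_inv1 (ltW q0)) ler_pdivrMr //.
  by rewrite mulrC; apply: le_trans; lra.
pose L := large_agreement f delta.
exists #|L|, (fun j => dot (enum_val j)); split.
- rewrite ler_pdivlMr ?exprn_gt0 //; apply: card_large_agreement => //.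
  have : delta ^+ 3 <= delta by rewrite ler_iXnr // ltW.
  by move/(ler_wpM2l (ltW q0)); lra.
- by move=> j; apply: dot_linear.
(* Positivity of eps makes the accepted set nonempty, so the conditional probability is a genuine
   quotient. *)
- have acc0 : 0 < #|accept_set f|%:R :> R by rewrite accE mulr_gt0 ?exprn_gt0.
  rewrite /unif_pr ler_pdivlMr // mulrBl mul1r lerBlDr.
  set good := [pred _ in _ | _].
  have := card_bad_large_agreement q_pr fZ delta0 d1 qd3.
  set bad := [set p in _ | _] => bad_le.
  have -> : 4 * (delta / eps) * #|accept_set f|%:R = 4 * delta * Q%:R ^+ 2.
    by rewrite accE; field; rewrite gt_eqF.
  (* It remains to see that every accepted pair is good or bad. *)
  apply: le_trans (_ : (#|good| + #|bad|)%:R <= _); last first.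
    by rewrite natrD lerD2l.
  rewrite ler_nat -(cardsE good).
  apply: leq_trans (leq_card_setU _ _).
  apply/subset_leq_card/subsetP => p pA; rewrite !inE; move: (pA); rewrite inE.
  move=> ->; rewrite /=; case: (boolP (_ == 1%N)) => [/cards1P[c cE]|]; last first.
    by rewrite orbT.
  rewrite orbF; apply/asboolP.
  have : c \in explaining L f p by rewrite cE set11.
  rewrite inE => /and3P[cL /eqP f1 /eqP f2].
  exists (enum_rank_in cL c).
  split=> [|j [g1 g2]]; first by rewrite enum_rankK_in.
  (* Uniqueness of the index: its form lies in the singleton [explaining L f p], and [enum_val] is
     injective. *)
  apply: enum_val_inj; rewrite enum_rankK_in //; apply/esym/set1P.
  by rewrite -cE inE -g1 -g2 !eqxx enum_valP.
Qed.
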